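(* (a) Let $R$ be an integral domain, $\pi\in R\setminus\{0\}$, and let $(X,v')$ and $(X,v)$ be weighted simplicial complexes on the same simplicial complex $X$ with coefficients in $R$, with $v(\sigma)=\pi^{\omega(\sigma)}$, $v'(\sigma)=\pi^{\omega'(\sigma)}$ and $\omega'(\sigma)\le\omega(\sigma)$ for all simplices $\sigma\in X$. Then there is a long exact sequence of homology $$\cdots\to H^v_{n+1}(X/\theta)\xrightarrow{\delta^v_{n+1}}H^{v'}_n(X)\xrightarrow{\theta_n}H^v_n(X)\xrightarrow{j}H^v_n(X/\theta)\xrightarrow{\delta^v_n}H^{v'}_{n-1}(X)\to\cdots,$$ where $\theta_n$ and $j$ denote the maps induced on homology by the chain map $\sigma\mapsto\frac{v(\sigma)}{v'(\sigma)}\sigma$ and by the quotient map, respectively, and the $\delta^v_n$ are connecting homomorphisms. (b) Suppose $R=\mathbb{F}[[\pi]]$, where $\mathbb{F}$ is a field and $\pi$ is the indeterminate, and $v'(\sigma)=1_R$ for all $\sigma$, so that $H^{v'}_n(X)\cong H_n(X,R)$ is simplicial homology with coefficients in $R$. Then the long exact sequence splits into the exact sequences (one for each $n$) $$0\to H_n(X,R)\xrightarrow{\theta_n}H^v_n(X)\xrightarrow{j}H^v_n(X/\theta)\to0.$$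
   Context: A weighted simplicial complex $(X,\omega)$ is a simplicial complex $X$ with a function $\omega\colon X\to\mathbb{N}=\{0,1,2,\dots\}$ on its simplices such that $\sigma\subseteq\tau$ implies $\omega(\sigma)\ge\omega(\tau)$. With $v(\sigma)=\pi^{\omega(\sigma)}\in R$ one also writes $(X,v)$. Fix a total order on the vertices of $X$, and for an $n$-simplex $\sigma$ let $\hat\sigma_i$ be its $i$-th face. $C_n(X,R)$ is the free $R$-module on the $n$-simplices of $X$, with weighted boundary map $\partial_n^v(\sigma)=\sum_{i=0}^n(-1)^i\frac{v(\hat\sigma_i)}{v(\sigma)}\hat\sigma_i=\sum_{i=0}^n(-1)^i\pi^{\omega(\hat\sigma_i)-\omega(\sigma)}\hat\sigma_i$ for $n\ge1$, and $\partial_0^v=0$. The weighted homology is $H_n^v(X)=\ker\partial_n^v/\mathrm{Im}\,\partial_{n+1}^v$. The $R$-linear maps $\theta_n\colon C_n(X,R)\to C_n(X,R)$, $\theta_n(\sigma)=\frac{v(\sigma)}{v'(\sigma)}\sigma=\pi^{\omega(\sigma)-\omega'(\sigma)}\sigma$, form an injective chain map from $(C_*(X,R),\partial^{v'})$ to $(C_*(X,R),\partial^v)$. Put $C_n(X/\theta)=C_n(X,R)/\theta_n(C_n(X,R))$, with boundary maps induced by $\partial^v_n$; $H^v_n(X/\theta)$ is the homology of this quotient complex, and $j\colon C_n(X,R)\to C_n(X/\theta)$ is the quotient map. *)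

(* Defs.v *)
From HB Require Import structures.
From mathcomp Require Import all_boot all_order all_algebra.
From mathcomp Require Import generic_quotient ring_quotient.
From mathcomp Require Import finmap.
From mathcomp Require Import boolp.
From mathcomp Require Import freeg zify.

Set Implicit Arguments.
Unset Strict Implicit.
Unset Printing Implicit Defensive.

Import Order.TTheory GRing.Theory.
Local Open Scope ring_scope.

Section Modules.
Variable R : comNzRingType.

Definition ker_pred (U V : lmodType R) (f : {linear U -> V}) : {pred U} :=
  fun x => f x == 0.

Fact ker_closed (U V : lmodType R) (f : {linear U -> V}) :
  submod_closed (ker_pred f).
Proof.
split=> [|a x y]; rewrite !unfold_in ?linear0 // => /eqP fx /eqP fy.
by rewrite linearP fx fy scaler0 addr0.
Qed.

HB.instance Definition _ (U V : lmodType R) (f : {linear U -> V}) :=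
  GRing.isSubmodClosed.Build R U (ker_pred f)
    (GRing.submod_closed_semi (ker_closed f)).

Definition ker (U V : lmodType R) (f : {linear U -> V}) : Type :=
  {x : U | ker_pred f x}.

HB.instance Definition _ (U V : lmodType R) (f : {linear U -> V}) :=
  SubChoice.on (ker f).
HB.instance Definition _ (U V : lmodType R) (f : {linear U -> V}) :=
  [SubChoice_isSubLmodule of ker f by <:].

Section KerMap.
Variables (U V U' V' : lmodType R).
Variables (f : {linear U -> V}) (f' : {linear U' -> V'}) (g : {linear U -> U'}).
Hypothesis gP : forall x, f x = 0 -> f' (g x) = 0.

Fact ker_map_proof (x : ker f) : ker_pred f' (g (val x)).
Proof. exact/eqP/gP/eqP/(valP x). Qed.

Definition ker_map (x : ker f) : ker f' := Sub (g (val x)) (ker_map_proof x).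

Fact ker_map_linear : linear ker_map.
Proof. by move=> a x y; apply: val_inj; rewrite /= linearP. Qed.
HB.instance Definition _ :=
  GRing.isLinear.Build R (ker f) (ker f') *:%R ker_map ker_map_linear.
End KerMap.

Definition im_pred (U V : lmodType R) (f : {linear U -> V}) : {pred V} :=
  fun y => `[< exists x, f x = y >].

Fact im_closed (U V : lmodType R) (f : {linear U -> V}) :
  submod_closed (im_pred f).
Proof.
split=> [|a y y']; rewrite !unfold_in.
  by apply/asboolP; exists 0; rewrite linear0.
move=> /asboolP[x <-] /asboolP[x' <-]; apply/asboolP.
by exists (a *: x + x'); rewrite linearP.
Qed.

HB.instance Definition _ (U V : lmodType R) (f : {linear U -> V}) :=
  GRing.isSubmodClosed.Build R V (im_pred f)
    (GRing.submod_closed_semi (im_closed f)).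

Section Coker.
Variables (U V : lmodType R) (f : {linear U -> V}).
Local Open Scope quotient_scope.

Definition coker : Type := Quotient.quot (im_pred f).
HB.instance Definition _ := GRing.Zmodule.on coker.

Definition coker_proj (y : V) : coker := \pi_(Quotient.quot (im_pred f)) y.

Definition coker_repr (q : coker) : V := repr (q : Quotient.quot (im_pred f)).

Fact coker_reprK : cancel coker_repr coker_proj.
Proof. exact: reprK. Qed.

Fact coker_projP (y y' : V) :
  coker_proj y = coker_proj y' <-> exists x, f x = y - y'.
Proof.
rewrite /coker_proj; split=> [/eqP|xy]; last apply/eqP.
  by rewrite -Quotient.idealrBE => /asboolP.
by rewrite -Quotient.idealrBE; apply/asboolP.
Qed.

Fact coker_projD y y' : coker_proj (y + y') = coker_proj y + coker_proj y'.
Proof. by rewrite /coker_proj !piE. Qed.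

Definition coker_scale (a : R) (q : coker) : coker :=
  coker_proj (a *: coker_repr q).

Fact coker_projZ a y : coker_proj (a *: y) = coker_scale a (coker_proj y).
Proof.
apply/coker_projP; have /coker_projP[x fx] := coker_reprK (coker_proj y).
by exists (- a *: x); rewrite linearZ /= fx scaleNr -scalerN opprB scalerBr.
Qed.

Fact coker_scaleA a b q : coker_scale a (coker_scale b q) = coker_scale (a * b) q.
Proof. by rewrite -[q]coker_reprK -!coker_projZ scalerA. Qed.
Fact coker_scale1 : left_id 1 coker_scale.
Proof. by move=> q; rewrite -[q]coker_reprK -!coker_projZ scale1r. Qed.
Fact coker_scaleDr : right_distributive coker_scale +%R.
Proof.
move=> a p q; rewrite -[p]coker_reprK -[q]coker_reprK -coker_projD -!coker_projZ.
by rewrite scalerDr coker_projD.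
Qed.
Fact coker_scaleDl q : {morph coker_scale^~ q : a b / a + b}.
Proof.
by move=> a b; rewrite -[q]coker_reprK -!coker_projZ scalerDl coker_projD.
Qed.

HB.instance Definition _ := GRing.Zmodule_isLmodule.Build R coker
  coker_scaleA coker_scale1 coker_scaleDr coker_scaleDl.

Fact coker_proj_linear : linear coker_proj.
Proof. by move=> a x y; rewrite coker_projD coker_projZ. Qed.
HB.instance Definition _ :=
  GRing.isLinear.Build R V coker *:%R coker_proj coker_proj_linear.
End Coker.

Section CokerMap.
Variables (U V U' V' : lmodType R).
Variables (f : {linear U -> V}) (f' : {linear U' -> V'}) (g : {linear V -> V'}).

Definition coker_map (gP : forall x, exists x', f' x' = g (f x)) :
    coker f -> coker f' :=
  fun q => coker_proj f' (g (coker_repr q)).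

Variable gP : forall x, exists x', f' x' = g (f x).

Fact coker_mapE y : coker_map gP (coker_proj f y) = coker_proj f' (g y).
Proof.
apply/coker_projP; have /coker_projP[x fx] := coker_reprK (coker_proj f y).
by have [x' fx'] := gP x; exists x'; rewrite fx' fx linearB.
Qed.

Fact coker_map_linear : linear (coker_map gP).
Proof.
move=> a p q; rewrite -[p]coker_reprK -[q]coker_reprK.
by rewrite -linearP /= !coker_mapE !linearP.
Qed.
HB.instance Definition _ :=
  GRing.isLinear.Build R (coker f) (coker f') *:%R (coker_map gP)
    coker_map_linear.
End CokerMap.

Definition exact_at (U V W : lmodType R) (f : U -> V) (g : V -> W) : Prop :=
  forall y, g y = 0 <-> exists x, f x = y.

End Modules.

Section Complexes.
Variable R : comNzRingType.

(* Since [0.-1 = 0], the boundary in degree 0 is an endomorphism of the degree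
   0 part, required to vanish. *)
Record chain_complex := ChainComplex {
  chain :> nat -> lmodType R;
  bd : forall n, {linear chain n -> chain n.-1};
  bd_low : forall x, bd 0 x = 0;
  bd_bd : forall n x, bd n (bd n.+1 x) = 0
}.

Record chain_map (A B : chain_complex) := ChainMap {
  cmap :> forall n, {linear A n -> B n};
  cmapP : forall n x, bd B n (cmap n x) = cmap n.-1 (bd A n x)
}.

Definition cycles (C : chain_complex) (n : nat) : lmodType R := ker (bd C n).

Section BdCycle.
Variables (C : chain_complex) (n : nat).

Fact bd_cycle_proof (x : C n.+1) : ker_pred (bd C n) (bd C n.+1 x).
Proof. exact/eqP/bd_bd. Qed.

Definition bd_cycle (x : C n.+1) : ker (bd C n) :=
  Sub (bd C n.+1 x) (bd_cycle_proof x).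

Fact bd_cycle_linear : linear bd_cycle.
Proof. by move=> a x y; apply: val_inj; rewrite /= linearP. Qed.
HB.instance Definition _ :=
  GRing.isLinear.Build R (C n.+1) (ker (bd C n)) *:%R bd_cycle bd_cycle_linear.
End BdCycle.

Arguments bd_cycle : clear implicits.

Definition homology (C : chain_complex) (n : nat) : lmodType R :=
  coker (bd_cycle C n).

Definition hclass (C : chain_complex) (n : nat) :
    {linear cycles C n -> homology C n} :=
  coker_proj (bd_cycle C n).

Section Induced.
Variables (A B : chain_complex) (f : chain_map A B) (n : nat).

Fact cmap_ker x : bd A n x = 0 -> bd B n (f n x) = 0.
Proof. by move=> dx; rewrite cmapP dx linear0. Qed.

Definition cycles_map : {linear cycles A n -> cycles B n} := ker_map cmap_ker.

Fact cycles_map_bd (x : A n.+1) :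
  exists y : B n.+1, bd_cycle B n y = cycles_map (bd_cycle A n x).
Proof. by exists (f n.+1 x); apply: val_inj; rewrite /= cmapP. Qed.

Definition hmap : {linear homology A n -> homology B n} :=
  coker_map cycles_map_bd.
End Induced.

Section Quotient.
Variables (A B : chain_complex) (f : chain_map A B).

Definition quot_chain (n : nat) : lmodType R := coker (f n).

Fact quot_bd_proof n (x : A n) :
  exists x' : A n.-1, f n.-1 x' = bd B n (f n x).
Proof. by exists (bd A n x); rewrite cmapP. Qed.

Definition quot_bd n : {linear quot_chain n -> quot_chain n.-1} :=
  coker_map (@quot_bd_proof n).

Fact quot_bd_low x : quot_bd 0 x = 0.
Proof. by rewrite -[x]coker_reprK /= coker_mapE bd_low linear0. Qed.

Fact quot_bd_bd n x : quot_bd n (quot_bd n.+1 x) = 0.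
Proof. by rewrite -[x]coker_reprK /= !coker_mapE bd_bd linear0. Qed.

Definition quot_complex := ChainComplex quot_bd_low quot_bd_bd.

Definition quot_cmap (n : nat) : {linear B n -> quot_complex n} :=
  coker_proj (f n).

Fact quot_cmapP n x : bd quot_complex n (quot_cmap n x) = quot_cmap n.-1 (bd B n x).
Proof. exact: coker_mapE. Qed.

Definition quot_map : chain_map B quot_complex := ChainMap quot_cmapP.

(* The connecting homomorphism of 0 -> A -f-> B -> B/f(A) -> 0: the class of
   a cycle [z] of the quotient is sent to the class of [a], where [z] lifts to
   a chain [x] of [B] with [bd x = f a]. *)
Definition is_connecting (n : nat)
    (delta : homology quot_complex n.+1 -> homology A n) : Prop :=
  forall (z : cycles quot_complex n.+1) (x : B n.+1) (a : cycles A n),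
    quot_map n.+1 x = val z -> bd B n.+1 x = f n (val a) ->
    delta (hclass quot_complex n.+1 z) = hclass A n a.
End Quotient.
End Complexes.

Section FreeLift.
Variables (R : comNzRingType) (K : choiceType) (M : lmodType R) (f : K -> M).

Fact fglift_linear : linear (fglift f : {freeg K / R} -> M).
Proof.
have fgE (D : {freeg K / R}) :
    fglift f D = \sum_(x <- dom D) coeff x D *: f x.
  have ad : additive (fglift f : {freeg K / R} -> M) by exact: lift_is_additive.
  pose h := GRing.isZmodMorphism.Build _ _ (fglift f : {freeg K / R} -> M) ad.
  pose g : {additive {freeg K / R} -> M} := HB.pack (fglift f) h.
  rewrite -{1}[D]freeg_sumE -[LHS]/(g _) raddf_sum /=.
  by apply: eq_bigr => x _; rewrite liftU.
move=> a D E.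
pose s := undup (dom D ++ dom E).
have fgsE (G : {freeg K / R}) : {subset dom G <= s} ->
    fglift f G = \sum_(x <- s) coeff x G *: f x.
  move=> sub; rewrite fgE (bigID (mem (dom G)) (r := s)) /= [X in _ = _ + X]big1.
    rewrite addr0 -[RHS]big_filter; apply: perm_big; apply: uniq_perm.
    - exact: uniq_dom.
    - by rewrite filter_uniq ?undup_uniq.
    by move=> x; rewrite mem_filter; case: (boolP (x \in dom G)) => //= /sub ->.
  by move=> x xG; rewrite coeff_outdom ?scale0r.
rewrite !fgsE ?scaler_sumr -?big_split /=.
- by apply: eq_bigr => x _; rewrite coeffD coeffZ scalerDl scalerA.
- by move=> x xE; rewrite mem_undup mem_cat xE orbT.
- by move=> x xD; rewrite mem_undup mem_cat xD.
move=> x; rewrite !mem_dom mem_undup mem_cat !mem_dom coeffD coeffZ.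
apply: contraNT; rewrite negb_or !negbK => /andP[/eqP -> /eqP ->].
by rewrite mulr0 addr0.
Qed.
HB.instance Definition _ :=
  GRing.isLinear.Build R {freeg K / R} M *:%R (fglift f) fglift_linear.
End FreeLift.

Section SimplicialComplexes.
Local Open Scope fset_scope.
Variables (d : Order.disp_t) (V : orderType d).

(* The total order on the vertices is the order of the ambient type [V]; not
   every element of [V] needs to be a vertex. *)
Record scomplex := SComplex {
  scomplex_pred :> pred {fset V};
  scomplex_neq0 : forall s, scomplex_pred s -> s != fset0;
  scomplex_sub : forall s t, scomplex_pred t ->
    s `<=` t -> s != fset0 -> scomplex_pred s
}.

Definition simplex (X : scomplex) : Type := {s : {fset V} | X s}.
HB.instance Definition _ (X : scomplex) := SubChoice.on (simplex X).

Definition nsimplex (X : scomplex) (n : nat) : Type :=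
  {s : simplex X | #|` val s| == n.+1}.
HB.instance Definition _ (X : scomplex) n := SubChoice.on (nsimplex X n).

Record weighting (X : scomplex) := Weighting {
  weight :> simplex X -> nat;
  weight_le : forall s t : simplex X, val s `<=` val t -> (weight t <= weight s)%N
}.

(* [s] with its [i]-th smallest vertex (counting from 0) removed. *)
Definition face_set (i : nat) (s : {fset V}) : {fset V} :=
  [fset x in s | index x (sort <=%O s) != i].

Fact face_set_sub i s : face_set i s `<=` s.
Proof. by apply/fsubsetP => x; rewrite !inE => /andP[]. Qed.

Fact card_face_set i s : (i < #|` s|)%N -> #|` face_set i s| = #|` s|.-1.
Proof.
move=> lt_i; have srt := perm_sort <=%O s.
have sz : size (sort <=%O s) = #|` s| by rewrite size_sort.
have [x0 xs] : exists x, x \in s by apply/fset0Pn; rewrite -cardfs_gt0; case: #|` s| lt_i.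
pose x := nth x0 (sort <=%O s) i.
have xin : x \in s by rewrite -(mem_sort <=%O) mem_nth ?sz.
have -> : face_set i s = s `\ x.
  apply/fsetP => y; rewrite !inE; case: (boolP (y \in s)) => [ys|]; last by rewrite andbF.
  rewrite andbT /=; congr negb; apply/eqP/eqP => [e|->].
    by rewrite /x -e nth_index ?mem_sort.
  by rewrite /x index_uniq ?sz ?sort_uniq ?fset_uniq.
by rewrite (cardfsD1 x s) xin.
Qed.

Fact index_filter_index (T : eqType) (l : seq T) j x :
  uniq l -> x \in l -> index x l != j ->
  index x [seq y <- l | index y l != j] = unbump j (index x l).
Proof.
elim: l j => //= a l IHl j /andP[al ul]; rewrite inE.
have in_l b k : {in l, (fun y => (if a == y then b else (index y l).+1) != k)
    =1 (fun y => (index y l).+1 != k)}.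
  by move=> y yl /=; case: (a =P y) => [ay|] //; rewrite ay yl in al.
case: j => [|j]; rewrite eqxx /= (eq_in_filter (in_l _ _)) /=.
  rewrite filter_predT [x == a]eq_sym; case: (a =P x) => //= _ _ _.
  by rewrite /unbump; lia.
rewrite [x == a]eq_sym; case: (a =P x) => //= _ xl; rewrite eqSS => /IHl ->//.
by rewrite /unbump ltnS; lia.
Qed.

Fact sort_face_set j s :
  sort <=%O (face_set j s) =
  [seq x <- sort <=%O s | index x (sort <=%O s) != j].
Proof.
apply: le_sorted_eq; rewrite ?sort_le_sorted //.
  by rewrite sorted_filter ?sort_le_sorted //; exact: le_trans.
apply: uniq_perm; rewrite ?filter_uniq ?sort_uniq ?fset_uniq // => x.
by rewrite mem_filter !mem_sort !inE andbC.
Qed.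

Fact face_setC i j s : (j <= i)%N ->
  face_set i (face_set j s) = face_set j (face_set i.+1 s).
Proof.
move=> le_ji; apply/fsetP => x; rewrite !inE /= !sort_face_set.
case: (boolP (x \in s)) => //= xs.
have us : uniq (sort <=%O s) by rewrite sort_uniq fset_uniq.
have xl : x \in sort <=%O s by rewrite mem_sort.
have E k := @index_filter_index _ _ k _ us xl.
set p := index x _ in E *.
case: (eqVneq p j) => [pj|pj]; case: (eqVneq p i.+1) => [pi|pi] //=;
  rewrite ?E //; move: pj pi le_ji; rewrite /unbump; clear; lia.
Qed.
End SimplicialComplexes.

Section Faces.
Local Open Scope fset_scope.
Variables (d : Order.disp_t) (V : orderType d) (X : scomplex V) (n : nat).
Variables (i : 'I_n.+2) (s : nsimplex X n.+1).

Fact card_face : #|` face_set i (val (val s))| == n.+1.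
Proof. by have /eqP cs := valP s; rewrite card_face_set cs. Qed.

Fact face_in : X (face_set i (val (val s))).
Proof.
apply: scomplex_sub (valP (val s)) (face_set_sub _ _) _.
by rewrite -cardfs_gt0 (eqP card_face).
Qed.

Definition face : nsimplex X n :=
  Sub (Sub (face_set i (val (val s))) face_in : simplex X) card_face.

Fact face_sub : val (val face) `<=` val (val s).
Proof. exact: face_set_sub. Qed.
End Faces.

Section Chains.
Variables (d : Order.disp_t) (V : orderType d) (R : comNzRingType).
Variable X : scomplex V.

Definition chains (n : nat) : lmodType R := {freeg (nsimplex X n) / R}.

Fact chains_ind n (P : chains n -> Prop) :
  P 0 -> (forall a s D, P D -> P (a *: << s >> + D)) -> forall D, P D.
Proof.
move=> P0 PD D; rewrite -[D]freeg_sumE; elim: (dom D) => [|s r IHr].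
  by rewrite big_nil.
rewrite big_cons; suff -> : << coeff s D *g s >> = coeff s D *: << s >> :> chains n.
  exact: PD.
by apply/eqP/freeg_eqP => t; rewrite coeffZ !coeffU mul1r.
Qed.

Fact chains_eq n (M : lmodType R) (f g : {linear chains n -> M}) :
  (forall s, f << s >> = g << s >>) -> f =1 g.
Proof.
move=> fg; apply: chains_ind => [|a s D fgD]; first by rewrite !linear0.
by rewrite !linearP fg fgD.
Qed.

Variables (pi : R) (w : weighting X).

(* The quotient [v(face)/v(s)] is [pi ^+ (w face - w s)], and the truncated
   subtraction is exact by [weight_le]. *)
Definition wbd (n : nat) : {linear chains n -> chains n.-1} :=
  match n with
  | 0 => \0
  | m.+1 => fglift (fun s : nsimplex X m.+1 =>
      \sum_(i < m.+2)
        ((-1) ^+ i * pi ^+ (w (val (face i s)) - w (val s))) *: << face i s >>)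
  end.

Fact wbd_low x : wbd 0 x = 0. Proof. by []. Qed.

Fact wbdE n (s : nsimplex X n.+1) : wbd n.+1 << s >> =
  \sum_(i < n.+2)
     ((-1) ^+ i * pi ^+ (w (val (face i s)) - w (val s))) *: << face i s >>.
Proof. by rewrite /= liftU scale1r. Qed.

Fact alternating_sum0 (M : lmodType R) (m : nat) (f : nat -> nat -> M) :
  (forall i j, (j <= i)%N -> f j i = - f i.+1 j) ->
  \sum_(j < m.+1) \sum_(i < m) f j i = 0.
Proof.
move=> fC.
rewrite (eq_bigr (fun j : 'I_m.+1 => \sum_(i < m | (j <= i)%N) f j i +
    \sum_(i < m | (i < j)%N) f j i)); last first.
  move=> j _; rewrite (bigID (fun i : 'I_m => (j <= i)%N)) /=; congr (_ + _).
  by apply: eq_bigl => i; rewrite ltnNge.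
rewrite big_split /= big_ord_recr /= [X in _ + X + _]big_pred0; last first.
  by move=> i; rewrite leqNgt ltn_ord.
rewrite addr0 big_ord_recl /= [X in _ + (X + _)]big_pred0 // add0r.
rewrite (exchange_big_dep xpredT) //= -big_split big1 //= => j _.
rewrite -[X in _ + X]opprK -sumrN; apply/eqP; rewrite subr_eq0; apply/eqP.
by apply: eq_bigr => i le_ij; rewrite fC // opprK.
Qed.

Fact wbd_wbd n x : wbd n (wbd n.+1 x) = 0.
Proof.
case: n x => [//|n] x.
suff /(_ x) : wbd n.+1 \o wbd n.+2 =1 (\0 : {linear chains n.+2 -> chains n}).
  by [].
apply: chains_eq => s; rewrite [LHS](_ : _ = wbd n.+1 (wbd n.+2 << s >>)) //.
rewrite wbdE linear_sum.
pose G (t : {fset V}) : chains n :=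
  oapp (fun u : simplex X => oapp (fun u' : nsimplex X n =>
    pi ^+ (w u - w (val s)) *: << u' >>) 0 (insub u)) 0 (insub t).
have GE t : G (val (val t)) = pi ^+ (w (val t) - w (val s)) *: << t >>.
  by rewrite /G valK /= valK.
pose f j i := (-1) ^+ (j + i) *: G (face_set i (face_set j (val (val s)))).
rewrite -[RHS](@alternating_sum0 _ n.+2 f).
  apply: eq_bigr => j _; rewrite linearZ /= -/(wbd n.+1) wbdE scaler_sumr.
  apply: eq_bigr => i _; rewrite /f.
  rewrite -[face_set i _]/(val (val (face i (face j s)))) GE.
  rewrite !scalerA; congr (_ *: _).
  rewrite mulrACA -!exprD; congr (_ * pi ^+ _).
  have telescope a b c : (a <= b -> b <= c -> (b - a) + (c - b) = c - a)%N by lia.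
  by apply: telescope; apply/weight_le/face_sub.
move=> i j le_ji; rewrite /f face_setC // -scaleNr; congr (_ *: _).
by rewrite addSn exprS mulN1r opprK addnC.
Qed.

Definition weighted_complex : chain_complex R := ChainComplex wbd_low wbd_wbd.

End Chains.

Section SimplicialChains.
Variables (d : Order.disp_t) (V : orderType d) (R : comNzRingType).
Variable X : scomplex V.

Local Notation C := (chains R X).

Definition sbd (n : nat) : {linear C n -> C n.-1} :=
  match n with
  | 0 => \0
  | m.+1 => fglift (fun s : nsimplex X m.+1 =>
      \sum_(i < m.+2) (-1) ^+ i *: << face i s >>)
  end.

Fact sbd_low x : sbd 0 x = 0. Proof. by []. Qed.

Fact sbdE n (s : nsimplex X n.+1) : sbd n.+1 << s >> =
  \sum_(i < n.+2) (-1) ^+ i *: << face i s >>.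
Proof. by rewrite /= liftU scale1r. Qed.

Fact wbd_sbd (pi : R) (w : weighting X) :
  (forall s, pi ^+ w s = 1) -> forall n x, wbd pi w n x = sbd n x.
Proof.
move=> w1 [//|n]; apply: chains_eq => s; rewrite wbdE sbdE.
apply: eq_bigr => i _; congr (_ *: _); rewrite -[RHS]mulr1; congr (_ * _).
have le_w := weight_le w (face_sub i s).
by rewrite -[LHS]mulr1 -[X in _ * X = _](w1 (val s)) -exprD subnK // w1.
Qed.

Fact sbd_sbd n x : sbd n (sbd n.+1 x) = 0.
Proof.
have w0P (s t : simplex X) : (val s `<=` val t)%fset -> (0 <= 0)%N by [].
rewrite -!(@wbd_sbd 1 (Weighting w0P)) ?wbd_wbd // => s; exact: expr1n.
Qed.

Definition simplicial_complex : chain_complex R := ChainComplex sbd_low sbd_sbd.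

End SimplicialChains.

Section ChainMaps.
Variables (d : Order.disp_t) (V : orderType d) (R : comNzRingType) (pi : R).
Variables (X : scomplex V) (w' w : weighting X).

Local Notation C := (chains R X).

(* The subtraction is exact when [w' <= w], as required in [theta]. *)
Definition theta_lin (n : nat) : {linear C n -> C n} :=
  fglift (fun s : nsimplex X n => pi ^+ (w (val s) - w' (val s)) *: << s >>).

Fact theta_linE n (s : nsimplex X n) :
  theta_lin n << s >> = pi ^+ (w (val s) - w' (val s)) *: << s >>.
Proof. by rewrite /= liftU scale1r. Qed.

Fact theta_linP : (forall s, w' s <= w s)%N ->
  forall n x, wbd pi w n (theta_lin n x) = theta_lin n.-1 (wbd pi w' n x).
Proof.
move=> le_w [|n] x; first by rewrite !wbd_low linear0.
suff /(_ x) : wbd pi w n.+1 \o theta_lin n.+1 =1 theta_lin n \o wbd pi w' n.+1.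
  by [].
apply: chains_eq => s.
rewrite [LHS](_ : _ = wbd pi w n.+1 (theta_lin n.+1 << s >>)) //.
rewrite [RHS](_ : _ = theta_lin n (wbd pi w' n.+1 << s >>)) //.
rewrite theta_linE linearZ /= -/(wbd pi w n.+1) !wbdE scaler_sumr.
rewrite (linear_sum (theta_lin n)); apply: eq_bigr => i _.
rewrite [RHS]linearZ /= -/(theta_lin n) theta_linE !scalerA mulrCA -!mulrA.
congr (_ * _ *: _); rewrite -!exprD; congr (_ ^+ _).
have chain_arith a b c e : (a <= b -> b <= c -> a <= e -> e <= c ->
    (b - a) + (c - b) = (e - a) + (c - e))%N by lia.
by apply: chain_arith; try apply/weight_le/face_sub; apply: le_w.
Qed.

Definition theta (le_w : forall s, (w' s <= w s)%N) :
    chain_map (weighted_complex pi w') (weighted_complex pi w) :=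
  @ChainMap R (weighted_complex pi w') (weighted_complex pi w)
    theta_lin (theta_linP le_w).

Definition simplicial_to_weighted (w1 : forall s, pi ^+ w' s = 1) :
    chain_map (simplicial_complex R X) (weighted_complex pi w') :=
  @ChainMap R (simplicial_complex R X) (weighted_complex pi w')
    (fun n => idfun) (wbd_sbd w1).

End ChainMaps.

Section PowerSeries.
Variable F : fieldType.

Record pseries : Type := PSeries { pscoef : nat -> F }.

HB.instance Definition _ := [isNew for pscoef].
HB.instance Definition _ := [Choice of pseries by <:].

Fact pseries_ext (p q : pseries) : pscoef p =1 pscoef q -> p = q.
Proof. by move=> pq; apply: val_inj; apply/funext. Qed.

Definition ps_zero := PSeries (fun=> 0).
Definition ps_opp p := PSeries (fun n => - pscoef p n).
Definition ps_add p q := PSeries (fun n => pscoef p n + pscoef q n).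

Fact ps_addA : associative ps_add.
Proof. by move=> p q r; apply: pseries_ext => n /=; rewrite addrA. Qed.
Fact ps_addC : commutative ps_add.
Proof. by move=> p q; apply: pseries_ext => n /=; rewrite addrC. Qed.
Fact ps_add0 : left_id ps_zero ps_add.
Proof. by move=> p; apply: pseries_ext => n /=; rewrite add0r. Qed.
Fact ps_addN : left_inverse ps_zero ps_opp ps_add.
Proof. by move=> p; apply: pseries_ext => n /=; rewrite addNr. Qed.
HB.instance Definition _ :=
  GRing.isZmodule.Build pseries ps_addA ps_addC ps_add0 ps_addN.

Definition ps_const (c : F) := PSeries (fun n => if n == 0 then c else 0).
Definition ps_mul p q :=
  PSeries (fun n => \sum_(i < n.+1) pscoef p i * pscoef q (n - i)).

(* Truncation transfers the ring laws from polynomials. *)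
Let trunc m (p : pseries) : {poly F} := \poly_(i < m.+1) pscoef p i.

Let ps_mulE m n p q (P Q : {poly F}) : (n <= m)%N ->
    (forall i, (i <= m)%N -> P`_i = pscoef p i) ->
    (forall i, (i <= m)%N -> Q`_i = pscoef q i) ->
  (P * Q)`_n = pscoef (ps_mul p q) n.
Proof.
move=> le_nm Pp Qq; rewrite coefM; apply: eq_bigr => i _.
by have := ltn_ord i; rewrite ltnS => le_in; rewrite Pp ?Qq //; lia.
Qed.

Let coef_trunc m i p : (i <= m)%N -> (trunc m p)`_i = pscoef p i.
Proof. by move=> le_im; rewrite coef_poly ltnS le_im. Qed.

Let ps_mul_trunc m i p q : (i <= m)%N ->
  (trunc m p * trunc m q)`_i = pscoef (ps_mul p q) i.
Proof. by move=> le_im; apply: (ps_mulE le_im) => j; exact: coef_trunc. Qed.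

Fact ps_mulC : commutative ps_mul.
Proof.
move=> p q; apply: pseries_ext => n.
by rewrite -!(ps_mul_trunc _ _ (leqnn n)) mulrC.
Qed.

Fact ps_mulA : associative ps_mul.
Proof.
move=> p q r; apply: pseries_ext => n.
have lhs : (trunc n p * (trunc n q * trunc n r))`_n =
    pscoef (ps_mul p (ps_mul q r)) n.
  by apply: (ps_mulE (leqnn n)) => i; [exact: coef_trunc | exact: ps_mul_trunc].
have rhs : (trunc n p * trunc n q * trunc n r)`_n =
    pscoef (ps_mul (ps_mul p q) r) n.
  by apply: (ps_mulE (leqnn n)) => i; [exact: ps_mul_trunc | exact: coef_trunc].
by rewrite -lhs -rhs mulrA.
Qed.

Fact ps_mul1 : left_id (ps_const 1) ps_mul.
Proof.
move=> p; apply: pseries_ext => n /=.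
rewrite big_ord_recl big1 /= ?mul1r ?subn0 ?addr0 // => i _.
by rewrite mul0r.
Qed.

Fact ps_mulDl : left_distributive ps_mul +%R.
Proof.
move=> p q r; apply: pseries_ext => n /=; rewrite -big_split.
by apply: eq_bigr => i _; rewrite mulrDl.
Qed.

Fact ps_const1_neq0 : ps_const 1 != 0.
Proof.
by apply/eqP => /(congr1 (pscoef^~ 0)) /eqP; rewrite /= oner_eq0.
Qed.

HB.instance Definition _ := GRing.Zmodule_isComNzRing.Build pseries
  ps_mulA ps_mulC ps_mul1 ps_mulDl ps_const1_neq0.

Definition ps_unit : pred pseries := fun p => `[< exists q, q * p = 1 >].

Definition ps_inv (p : pseries) : pseries :=
  match pselect (exists q, q * p = 1) with
  | left ex => projT1 (cid ex)
  | right _ => p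
  end.

Fact ps_mulV : {in ps_unit, left_inverse 1 ps_inv *%R}.
Proof.
move=> p /asboolP ex; rewrite /ps_inv; case: pselect => // {}ex.
exact: projT2 (cid ex).
Qed.

Fact ps_unitP p q : q * p = 1 -> ps_unit p.
Proof. by move=> qp; apply/asboolP; exists q. Qed.

Fact ps_inv_out : {in [predC ps_unit], ps_inv =1 id}.
Proof. by move=> p /asboolP nex; rewrite /ps_inv; case: pselect. Qed.

HB.instance Definition _ := GRing.ComNzRing_hasMulInverse.Build pseries
  ps_mulV ps_unitP ps_inv_out.

Fact ps_neq0 (p : pseries) : p != 0 ->
  exists2 n, pscoef p n != 0 & forall i, (i < n)%N -> pscoef p i = 0.
Proof.
move=> p0; have ex : exists n, pscoef p n != 0.
  apply: contrapT => nex; case/eqP: p0; apply: pseries_ext => n.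
  by apply/eqP; apply: contrapT => /negP pn; apply: nex; exists n.
case: (ex_minnP ex) => n pn nmin; exists n => // i lt_in.
by apply/eqP; apply: contraTT lt_in => /nmin; rewrite -leqNgt.
Qed.

Fact ps_integral : GRing.integral_domain_axiom pseries.
Proof.
move=> p q pq0; apply: contrapT => /negP; rewrite negb_or => /andP[].
move=> /ps_neq0[m pm mmin] /ps_neq0[n qn nmin].
have := congr1 (pscoef^~ (m + n)%N) pq0 => /=.
have lt_m : (m < (m + n).+1)%N by rewrite ltnS leq_addr.
rewrite (bigD1 (Ordinal lt_m)) //= big1 => [|i].
  by move/eqP; rewrite addr0 addKn mulf_eq0 (negPf pm) (negPf qn).
rewrite -val_eqE /=; case: ltngtP => // [lt_im|lt_mi] _.
  by rewrite mmin ?mul0r.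
by rewrite nmin ?mulr0 //; have := ltn_ord i; lia.
Qed.

HB.instance Definition _ :=
  GRing.ComUnitRing_isIntegral.Build pseries ps_integral.

Definition psX : pseries := PSeries (fun n => if n == 1%N then 1 else 0).
End PowerSeries.

(* Main.v *)
Require Import Defs.
From HB Require Import structures.
From mathcomp Require Import all_boot all_order all_algebra.
From mathcomp Require Import boolp freeg.

Set Implicit Arguments.
Unset Strict Implicit.
Unset Printing Implicit Defensive.

Import Order.TTheory GRing.Theory.
Local Open Scope ring_scope.

(** The idea of the proof.

    Part (a) is the long exact sequence of the short exact sequence of chain
    complexes [0 -> A -f-> B -> B / f(A) -> 0], taken for [f = theta].  It
    holds for every chain map [f] that is injective in each degree, and that
    is the generality of [connecting_exists] and the exactness lemmas around
    it.  The connecting homomorphism is obtained from the relation [connects],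
    which is the graph described by the usual zigzag: this relation is total,
    single-valued and compatible with linear combinations, so it is the graph
    of a linear map.  The special feature of [theta] is only its injectivity:
    it multiplies the coefficient at a simplex by a power of [pi], and [R] has
    no zero divisors.

    Part (b) says that the connecting homomorphisms vanish, that is, that
    [theta] is injective on homology.  This holds because [theta] has a
    retraction that commutes with the boundary maps, though it is not linear
    over [R] = F[[pi]].  Let [D] be the shift [sum a_k pi^k |-> sum a_(k+1)
    pi^k], an additive left inverse of multiplication by [pi], and send
    [a sigma] to [D^(w sigma) (a) sigma].  Since [D^m (pi^(m-k) a) = D^k a],
    the powers of [pi] in the weighted boundary are absorbed, which leaves the
    simplicial boundary; its coefficients are signs, and those commute with
    the additive map [D].  The same identity with [k = 0] shows that the map
    is a left inverse of [theta].  A cycle [z] with [theta z] a boundary is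
    then itself a boundary, as one sees by applying the retraction
    ([hmap_retract_inj]). *)

(** * Homology classes and induced maps *)

Section Classes.
Variable R : comNzRingType.

Lemma hclass_surj (C : chain_complex R) n (q : homology C n) :
  exists z : cycles C n, hclass C n z = q.
Proof. by exists (coker_repr q); rewrite /= coker_reprK. Qed.

Lemma hclass_eq (C : chain_complex R) n (z z' : cycles C n) :
  hclass C n z = hclass C n z' <->
  exists x, bd C n.+1 x = val z - val z'.
Proof.
split=> [/coker_projP[x xz]|[x xz]].
  by exists x; rewrite -[LHS]/(val (bd_cycle x)) xz.
by apply/coker_projP; exists x; apply: val_inj.
Qed.

Lemma hclass_eq0 (C : chain_complex R) n (z : cycles C n) :
  hclass C n z = 0 <-> exists x, bd C n.+1 x = val z.
Proof.
have -> : (0 : homology C n) = hclass C n 0 by rewrite linear0.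
by rewrite hclass_eq; split=> -[x xz]; exists x; rewrite xz subr0.
Qed.

Lemma cycle_bd0 (C : chain_complex R) n (z : cycles C n) : bd C n (val z) = 0.
Proof. exact/eqP/(valP z). Qed.

Lemma cycle_of (C : chain_complex R) n (x : C n) :
  bd C n x = 0 -> exists z : cycles C n, val z = x.
Proof. by move=> /eqP dx; exists (Sub x dx : ker (bd C n)). Qed.

Lemma hmapE (A B : chain_complex R) (f : chain_map A B) n (z : cycles A n) :
  hmap f n (hclass A n z) = hclass B n (cycles_map f n z).
Proof. exact: coker_mapE. Qed.

Variables (A B : chain_complex R) (f : chain_map A B).

Lemma hmapK (g : chain_map B A) :
  (forall n, cancel (f n) (g n)) -> forall n, cancel (hmap f n) (hmap g n).
Proof.
move=> fK n q; have [z <-] := hclass_surj q.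
by rewrite !hmapE; congr (hclass _ _ _); apply: val_inj; rewrite /= fK.
Qed.

(** The retraction need not be linear, nor even additive: it only has to carry
    a chain that bounds [f z] to a chain that bounds [z]. *)
Lemma hmap_retract_inj (r : forall n, B n -> A n) :
  (forall n, cancel (f n) (r n)) ->
  (forall n y, r n (bd B n.+1 y) = bd A n.+1 (r n.+1 y)) ->
  forall n, injective (hmap f n).
Proof.
move=> fK rbd n.
suff ker0 q : hmap f n q = 0 -> q = 0 by exact: raddf_inj ker0.
have [z <-] := hclass_surj q; rewrite hmapE => /hclass_eq0[y /= yz].
by apply/hclass_eq0; exists (r n.+1 y); rewrite -rbd yz fK.
Qed.

End Classes.

(** * The long exact sequence of an injective chain map *)

(** The values are chosen without regard to the module structure; the function
    is linear because [G] leaves only one choice. *)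
Lemma linear_rel_fun (R : comNzRingType) (U V : lmodType R)
    (G : U -> V -> Prop) :
  (forall u, exists v, G u v) ->
  (forall u v v', G u v -> G u v' -> v = v') ->
  (forall a u u' v v', G u v -> G u' v' -> G (a *: u + u') (a *: v + v')) ->
  exists g : {linear U -> V}, forall u, G u (g u).
Proof.
move=> tot fn lin; pose g u := projT1 (cid (tot u)).
have gP u : G u (g u) := projT2 (cid (tot u)).
have gL : linear g by move=> a u u'; apply: fn (gP _) (lin _ _ _ _ _ _ _).
pose gh := GRing.isLinear.Build R U V *:%R g gL.
pose gl : {linear U -> V} := HB.pack g gh.
by exists gl.
Qed.

Section LongExact.
Variables (R : comNzRingType) (A B : chain_complex R) (f : chain_map A B).
Local Notation Q := (quot_complex f).
Local Notation j := (quot_map f).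

Lemma quot_map_surj n (q : Q n) : exists x, j n x = q.
Proof. by exists (coker_repr q); exact: coker_reprK. Qed.

Lemma quot_map_eq n x x' : j n x = j n x' <-> exists a, f n a = x - x'.
Proof. exact: coker_projP. Qed.

Lemma quot_map_eq0 n x : j n x = 0 <-> exists a, f n a = x.
Proof.
by rewrite -(linear0 (j n)) quot_map_eq; split=> -[a fa]; exists a;
  rewrite fa subr0.
Qed.

Lemma hmap_quot_comp n (q : homology A n) : hmap j n (hmap f n q) = 0.
Proof.
have [z <-] := hclass_surj q; rewrite !hmapE; apply/hclass_eq0; exists 0.
by rewrite linear0; apply/esym/quot_map_eq0; exists (val z).
Qed.

Lemma hmap_quot0_surj (q : homology Q 0) : exists y, hmap j 0 y = q.
Proof.
have [z <-] := hclass_surj q; have [x xz] := quot_map_surj (val z).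
have [y yx] := cycle_of (bd_low x).
by exists (hclass B 0 y); rewrite hmapE; congr (hclass _ _ _); apply: val_inj;
  rewrite /= yx.
Qed.

Definition connects n (q : homology Q n.+1) (h : homology A n) : Prop :=
  exists z x a, [/\ hclass Q n.+1 z = q, hclass A n a = h,
    j n.+1 x = val z & bd B n.+1 x = f n (val a)].

Hypothesis f_inj : forall n, injective (f n).

Lemma cycle_of_im n (a : A n) : bd B n (f n a) = 0 -> bd A n a = 0.
Proof. by rewrite cmapP => fda; apply: f_inj; rewrite fda linear0. Qed.

Lemma hmap_exact_mid n : exact_at (hmap f n) (hmap j n).
Proof.
move=> q; split=> [|[p <-]]; last exact: hmap_quot_comp.
have [z <-] := hclass_surj q; rewrite hmapE => /hclass_eq0[y].
have [x <-] := quot_map_surj y; rewrite cmapP /= => /esym/quot_map_eq[a fa].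
have [c ca] : exists c : cycles A n, val c = a.
  by apply/cycle_of/cycle_of_im; rewrite fa linearB cycle_bd0 sub0r bd_bd oppr0.
exists (hclass A n c); rewrite hmapE; apply/hclass_eq; exists (- x).
by rewrite linearN /= ca fa addrAC subrr sub0r.
Qed.

Lemma connects_total n q : exists h, @connects n q h.
Proof.
have [z <-] := hclass_surj q; have [x xz] := quot_map_surj (val z).
have [a fa] : exists a, f n a = bd B n.+1 x.
  apply/quot_map_eq0/(etrans (esym (cmapP j x))).
  by rewrite xz cycle_bd0.
have [c ca] : exists c : cycles A n, val c = a.
  by apply/cycle_of/cycle_of_im; rewrite fa bd_bd.
by exists (hclass A n c), z, x, c; split; rewrite // ca.
Qed.

Lemma connects_linear n a q q' h h' :
  @connects n q h -> connects q' h' -> connects (a *: q + q') (a *: h + h').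
Proof.
move=> [z [x [c [zq ch xz xc]]]] [z' [x' [c' [zq' ch' xz' xc']]]].
exists (a *: z + z'), (a *: x + x'), (a *: c + c').
by split; rewrite !linearP ?zq ?zq' ?ch ?ch' ?xz ?xz' ?xc ?xc'.
Qed.

(** By linearity this is all of the independence of choices.  A chain [y] that
    bounds [z] in the quotient lifts to [u], and [x] differs from the boundary
    of [u] by some [f b]; since the boundary of that boundary vanishes, [b]
    bounds [c]. *)
Lemma connects0 n h : @connects n 0 h -> h = 0.
Proof.
move=> [z [x [c [/hclass_eq0[y yz] <- xz xc]]]]; apply/hclass_eq0.
have [u uy] := quot_map_surj y.
have [b fb] : exists b, f n.+1 b = x - bd B n.+2 u.
  by apply/quot_map_eq; rewrite xz -yz -uy cmapP.
by exists b; apply: f_inj; rewrite -cmapP fb linearB /= bd_bd subr0.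
Qed.

Lemma connects_fun n q h h' : @connects n q h -> connects q h' -> h = h'.
Proof.
move=> qh qh'; apply/esym/eqP; rewrite -subr_eq0; apply/eqP/connects0.
have := connects_linear (-1) qh qh'.
by rewrite !scaleN1r addNr addrC.
Qed.

Lemma connecting_exists :
  exists delta : forall n, {linear homology Q n.+1 -> homology A n},
    forall n q, connects q (delta n q).
Proof.
have D n : { g : {linear homology Q n.+1 -> homology A n} |
             forall q, connects q (g q) }.
  apply: cid; apply: linear_rel_fun; first exact: connects_total.
    exact: connects_fun.
  exact: connects_linear.
by exists (fun n => projT1 (D n)) => n; exact: projT2 (D n).
Qed.

Variable delta : forall n, {linear homology Q n.+1 -> homology A n}.
Hypothesis deltaP : forall n q, connects q (delta n q).

Lemma connects_delta n q h : connects q h -> delta n q = h.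
Proof. exact: connects_fun (deltaP q). Qed.

Lemma connects_is_connecting n : is_connecting (delta n).
Proof. by move=> z x a xz xa; apply: connects_delta; exists z, x, a. Qed.

Lemma delta_hmap_exact n : exact_at (delta n) (hmap f n).
Proof.
move=> h; split=> [|[q <-]]; last first.
  have [z [x [c [_ <- _ xc]]]] := deltaP q.
  by rewrite hmapE; apply/hclass_eq0; exists x.
have [c <-] := hclass_surj h; rewrite hmapE => /hclass_eq0[x /= xc].
have [z zx] : exists z : cycles Q n.+1, val z = j n.+1 x.
  by apply: cycle_of; rewrite cmapP xc; apply/quot_map_eq0; exists (val c).
by exists (hclass Q n.+1 z); apply: connects_delta; exists z, x, c.
Qed.

Lemma hmap_delta_exact n : exact_at (hmap j n.+1) (delta n).
Proof.
move=> q; split=> [dq|[p <-]]; last first.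
  have [y <-] := hclass_surj p; rewrite hmapE; apply: connects_delta.
  exists (cycles_map j n.+1 y), (val y), 0.
  by split; rewrite ?linear0 ?cycle_bd0.
have := deltaP q; rewrite dq => -[z [x [c [<- /hclass_eq0[b bc] xz xc]]]].
(* The lift [x] of [z] becomes a cycle once the part of it that comes from [A]
   is removed, and this does not change its image in the quotient. *)
have [y yx] : exists y : cycles B n.+1, val y = x - f n.+1 b.
  by apply: cycle_of; rewrite linearB xc cmapP bc subrr.
exists (hclass B n.+1 y); rewrite hmapE; congr (hclass _ _ _); apply: val_inj.
rewrite /= yx -xz; apply/quot_map_eq; exists (- b).
by rewrite linearN addrAC subrr sub0r.
Qed.

End LongExact.

(** When [f] is injective on homology, the connecting map out of degree [n.+1]
    vanishes by exactness, so every class of the quotient lifts. *)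
Lemma hmap_quot_surj (R : comNzRingType) (A B : chain_complex R)
    (f : chain_map A B) :
  (forall n, injective (f n)) -> (forall n, injective (hmap f n)) ->
  forall n q, exists y, hmap (quot_map f) n y = q.
Proof.
move=> f_inj hf_inj [|n] q; first exact: hmap_quot0_surj.
have [delta deltaP] := connecting_exists f_inj.
apply/(hmap_delta_exact f_inj deltaP)/hf_inj; rewrite linear0.
by apply/(delta_hmap_exact f_inj deltaP); exists q.
Qed.

(** * Additive operations on the coefficients of chains *)

Section Coefwise.
Variables (R : comNzRingType) (K : choiceType) (phi : K -> R -> R).

Definition coefwise (c : {freeg K / R}) : {freeg K / R} :=
  \sum_(s <- dom c) << phi s (coeff s c) *g s >>.

Hypothesis phi0 : forall s, phi s 0 = 0.

Lemma coeff_coefwise t c : coeff t (coefwise c) = phi t (coeff t c).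
Proof.
rewrite /coefwise raddf_sum /=; have [tc|tc] := boolP (t \in dom c).
  rewrite (bigD1_seq t) ?uniq_dom //= coeffU eqxx mulr1 big1 ?addr0 // => s st.
  by rewrite coeffU (negPf st) mulr0.
rewrite (coeff_outdom tc) phi0 big_seq big1 // => s sc.
by rewrite coeffU; case: eqP => [st|_]; [rewrite -st sc in tc | rewrite mulr0].
Qed.

Hypothesis phiD : forall s, {morph phi s : a b / a + b}.

Lemma coefwiseD : {morph coefwise : c e / c + e}.
Proof.
by move=> c e; apply/eqP/freeg_eqP => t; rewrite !(coeffD, coeff_coefwise) phiD.
Qed.

Lemma coefwise0 : coefwise 0 = 0.
Proof.
by apply/eqP/freeg_eqP => t; rewrite coeff_coefwise !coeff0.
Qed.

Lemma coefwiseU a s : coefwise (a *: << s >>) = phi s a *: << s >>.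
Proof.
apply/eqP/freeg_eqP => t; rewrite coeff_coefwise !coeffZ !coeffU !mul1r.
by case: eqP => [->|_]; rewrite ?mulr1 // !mulr0.
Qed.

End Coefwise.

(** * Injectivity of theta *)

Lemma coeff_theta_lin d (V : orderType d) (R : comNzRingType) (pi : R)
    (X : scomplex V) (w' w : weighting X) n (c : chains R X n) s :
  coeff s (theta_lin pi w' w n c)
    = pi ^+ (w (val s) - w' (val s)) * coeff s c.
Proof.
elim/chains_ind: c => [|a t c IHc]; first by rewrite linear0 !coeff0 mulr0.
rewrite linearP theta_linE scalerA !coeffD !coeffZ IHc mulrDr !coeffU !mul1r.
by case: eqP => [->|_]; rewrite ?mulr0 // !mulr1 mulrC.
Qed.

Lemma theta_inj d (V : orderType d) (R : idomainType) (pi : R)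
    (X : scomplex V) (w' w : weighting X)
    (le_w : forall s : simplex X, (w' s <= w s)%N) :
  pi != 0 -> forall n, injective (theta pi le_w n).
Proof.
move=> pi0 n c e ce; apply/eqP/freeg_eqP => s.
have := congr1 (coeff s) ce; rewrite /= !coeff_theta_lin.
exact: mulfI (expf_neq0 _ pi0) _ _.
Qed.

(** * A retraction of theta that is not linear *)

Section Retraction.
Variables (d : Order.disp_t) (V : orderType d) (R : comNzRingType) (pi : R).
Variables (X : scomplex V) (w' w : weighting X).
Hypothesis le_w : forall s : simplex X, (w' s <= w s)%N.
Hypothesis w'1 : forall s, pi ^+ w' s = 1.
Variable D : {additive R -> R}.
Hypothesis DK : forall a, D (pi * a) = a.

Lemma iter_divD k : {morph iter k D : a b / a + b}.
Proof. by elim: k => // k IHk a b; rewrite !iterS IHk raddfD. Qed.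

Lemma iter_div0 k : iter k D 0 = 0.
Proof. by elim: k => // k IHk; rewrite iterS IHk raddf0. Qed.

Lemma iter_div_sign k i a : iter k D ((-1) ^+ i * a) = (-1) ^+ i * iter k D a.
Proof.
rewrite -signr_odd; case: (odd i); rewrite ?expr0 ?expr1 ?mul1r // !mulN1r.
by elim: k => // k IHk; rewrite !iterS IHk raddfN.
Qed.

Lemma iter_div_expr k a : iter k D (pi ^+ k * a) = a.
Proof.
by elim: k a => [|k IHk] a; rewrite ?mul1r // iterSr exprS -mulrA DK IHk.
Qed.

Lemma iter_div_exprB m k a : (k <= m)%N ->
  iter m D (pi ^+ (m - k) * a) = iter k D a.
Proof. by move=> km; rewrite -{1}(subnKC km) iterD iter_div_expr. Qed.

Definition div_weight n : chains R X n -> chains R X n :=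
  coefwise (fun s : nsimplex X n => iter (w (val s)) D).

Lemma div_weightD n : {morph @div_weight n : c e / c + e}.
Proof. by apply: coefwiseD => s; [exact: iter_div0 | exact: iter_divD]. Qed.

Lemma div_weight0 n : @div_weight n 0 = 0.
Proof. by apply: coefwise0 => s; exact: iter_div0. Qed.

Lemma div_weightU n a (s : nsimplex X n) :
  div_weight (a *: << s >>) = iter (w (val s)) D a *: << s >>.
Proof. by apply: coefwiseU => t; exact: iter_div0. Qed.

Lemma div_weight_theta n : cancel (theta_lin pi w' w n) (@div_weight n).
Proof.
move=> c; apply/eqP/freeg_eqP => s.
rewrite coeff_coefwise => [|t]; last exact: iter_div0.
rewrite coeff_theta_lin -[pi ^+ _]mulr1 -(w'1 (val s)) -exprD subnK //.
exact: iter_div_expr.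
Qed.

(** The target carries the simplicial boundary, where no power of [pi] is left:
    [D] commutes with signs, but in general not with multiplication by [pi]. *)
Lemma div_weight_bd n y :
  div_weight (wbd pi w n.+1 y) = sbd R X n.+1 (div_weight y).
Proof.
elim/chains_ind: y => [|a s y IHy]; first by rewrite linear0 !div_weight0 linear0.
rewrite linearP !div_weightD IHy div_weightU linearD linearZ /=; congr (_ + _).
rewrite -/(sbd R X n.+1) sbdE -/(wbd pi w n.+1) wbdE !scaler_sumr.
rewrite (big_morph _ (@div_weightD n) (@div_weight0 n)).
apply: eq_bigr => i _; rewrite !scalerA div_weightU; congr (_ *: _).
rewrite mulrC -mulrA iter_div_sign iter_div_exprB 1?mulrC //.
exact/weight_le/face_sub.
Qed.

Lemma hmap_theta_inj n : injective (hmap (theta pi le_w) n).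
Proof.
apply: (@hmap_retract_inj _ _ _ (theta pi le_w) (@div_weight)) => {}n.
  exact: div_weight_theta.
by move=> y; rewrite [LHS]div_weight_bd -(wbd_sbd w'1).
Qed.

End Retraction.

Lemma hmap_simplicial_bij d (V : orderType d) (R : comNzRingType) (pi : R)
    (X : scomplex V) (w' : weighting X) (w'1 : forall s, pi ^+ w' s = 1) n :
  bijective (hmap (simplicial_to_weighted w'1) n).
Proof.
pose g := @ChainMap R (weighted_complex pi w') (simplicial_complex R X)
  (fun n => idfun) (fun n x => esym (wbd_sbd w'1 x)).
by exists (hmap g n); apply: hmapK.
Qed.

(** * Power series *)

Section Shift.
Variable F : fieldType.

Definition ps_shift (p : pseries F) : pseries F :=
  PSeries (fun n => pscoef p n.+1).

Lemma ps_shift_zmod_morphism : zmod_morphism ps_shift.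
Proof. by move=> p q; apply: pseries_ext. Qed.

HB.instance Definition _ :=
  GRing.isZmodMorphism.Build (pseries F) (pseries F) ps_shift ps_shift_zmod_morphism.

Lemma ps_shiftK p : ps_shift (psX F * p) = p.
Proof.
apply: pseries_ext => n /=; rewrite !big_ord_recl /= mul0r add0r mul1r subSS.
by rewrite subn0 big1 ?addr0 // => i _; rewrite mul0r.
Qed.

Lemma psX_neq0 : psX F != 0.
Proof.
by apply/eqP => /(congr1 (fun p => pscoef p 1%N))/eqP; rewrite /= oner_eq0.
Qed.

End Shift.

Theorem theorem2 (d : Order.disp_t) (V : orderType d) (X : scomplex V)
    (w' w : weighting X) (le_w : forall s : simplex X, (w' s <= w s)%N) :
  (forall (R : idomainType) (pi : R), pi != 0 ->
     let th := theta pi le_w in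
     let j := quot_map th in
     exists delta : forall n : nat,
       {linear homology (quot_complex th) n.+1 ->
               homology (weighted_complex pi w') n},
     [/\ forall n : nat, is_connecting (delta n),
         forall n : nat, exact_at (delta n) (hmap th n),
         forall n : nat, exact_at (hmap th n) (hmap j n),
         forall n : nat, exact_at (hmap j n.+1) (delta n) &
         forall z : homology (quot_complex th) 0,
           exists y : homology (weighted_complex pi w) 0, hmap j 0 y = z])
  /\
  (forall (F : fieldType)
      (v'1 : forall s : simplex X, psX F ^+ w' s = 1) (n : nat),
     let th := theta (psX F) le_w in
     let j := quot_map th in
     let iso := hmap (simplicial_to_weighted v'1) n in
     let th_simp :=
       fun x : homology (simplicial_complex (pseries F) X) n =>
         hmap th n (iso x) in
     [/\ bijective iso,
         injective th_simp,
         exact_at th_simp (hmap j n) &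
         forall z : homology (quot_complex th) n,
           exists y : homology (weighted_complex (psX F) w) n,
             hmap j n y = z]).
Proof.
split=> [R pi pi0 th j | F v'1 n th j iso th_simp].
  have th_inj n : injective (th n) by exact: theta_inj.
  have [delta deltaP] := connecting_exists th_inj.
  exists delta; split=> [n|n|n|n|z].
  - exact: connects_is_connecting.
  - exact: delta_hmap_exact.
  - exact: hmap_exact_mid.
  - exact: hmap_delta_exact.
  - exact: hmap_quot0_surj.
have th_inj m : injective (th m) by exact: theta_inj (psX_neq0 F) m.
have hth_inj := @hmap_theta_inj _ _ _ _ _ _ _ le_w v'1 _ (@ps_shiftK F).
have iso_bij : bijective iso := hmap_simplicial_bij v'1 n.
split.
- exact: iso_bij.
- exact: inj_comp (hth_inj n) (bij_inj iso_bij).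
- have [iso' _ isoK] := iso_bij.
  have th_exact : exact_at (hmap th n) (hmap j n) by exact: hmap_exact_mid.
  move=> y; split=> [/th_exact[x <-]|[x <-]].
    by exists (iso' x); exact: (congr1 (hmap th n) (isoK x)).
  exact/(th_exact (th_simp x)).2/(ex_intro _ (iso x) erefl).
- exact: hmap_quot_surj th_inj hth_inj n.
Qed.
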